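(* Let $P$ be a partition of a subset $S$ of $S_c$ and $C$ a straightening set of $P$ such that $P$ is $C$-confluent. Let $o\in O_c$ with $o\notin S$. (1) If $P'$ is $P$ with $o$ added to one of the parts of $P$, then $P'$ is $C$-confluent. (2) If $P'$ is $P$ with $\{o\}$ added as a new part of size $1$, then $P'$ is $(C\cup\{o\})$-confluent.
   Context: Fix positive integers $c\le n$. $S_m$ is the set of permutations of $\{1,\dots,m\}$ written as words. A word $w_1\cdots w_c$ (distinct integer letters) forms $u\in S_c$ if there is an integer $k$ with $w_i=u_i+k$ for all $i$. A hit in $w\in S_n$ is a contiguous subword of length $c$ forming some $u\in S_c$. For a partition $P$ of a subset of $S_c$, a $P$-hit is a hit forming a permutation in some part of $P$; a $P$-rearrangement rearranges the letters of a $P$-hit in place so that the new subword forms a permutation in the same part of $P$. Tail size of a word $w$ of length $m$ with distinct letters: least $k\ge1$ such that the first $k$ letters are the $k$ smallest letters of $w$. $w$ is right leaning if its tail size is $<m$, left leaning if its reversal has tail size $<m$, omni leaning if neither. $O_c$: the omni leaning permutations in $S_c$. Polarization of a hit $h$ in $w\in S_n$: if $h$ is all of $w$, $h$ is left polarized. Otherwise let $a$ be the average of the letters of $h$, $w'$ be $w$ with $h$ replaced by the single letter $a$, and $b$ the letter adjacent to $a$ in $w'$ closest in value to $a$ (ties: the left one). If $a,b$ appear in increasing order in $w'$, $h$ is right polarized; if decreasing, left polarized. A hit is backward if it is right polarized and left leaning, or left polarized and right leaning, or omni leaning; otherwise forward. A straightening set $C$ of $P$ is a set of permutations from the parts of $P$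 containing exactly: one left leaning permutation from each part containing a left leaning permutation, one right leaning permutation from each part containing a right leaning permutation, and one permutation from each part containing only omni leaning permutations. A $P$-hit $h$ is $(P,C)$-straightened if it forms a permutation in $C$ and either it is forward, or it is backward and no $P$-rearrangement of $h$ makes it forward. $(P,C)$-straightening a $P$-hit means applying a $P$-rearrangement so it becomes $(P,C)$-straightened. The $(P,C)$-straightening operator $\to$ on $S_n$: $w\to w'$ iff $w'$ is obtained from $w$ by $(P,C)$-straightening a not-yet-$(P,C)$-straightened $P$-hit of $w$. A relation $\to$ on a finite set $A$ with reflexive-transitive closure $\to'$ is confluent if there are no distinct $a,b$ with $a\to'b$ and $b\to'a$, and each connected component $K$ of $(A,\to)$ has a unique node $m$ with $x\to'm$ for all $x\in K$. $P$ is $C$-confluent if the $(P,C)$-straightening operator on $S_n$ is confluent. *)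

(* Defs.v *)
From mathcomp Require Import all_boot all_order all_algebra all_fingroup.
From Stdlib Require Import Relation_Operators.

Set Implicit Arguments.
Unset Strict Implicit.
Unset Printing Implicit Defensive.

Import Order.TTheory GRing.Theory Num.Theory.
Local Open Scope ring_scope.

(* 'S_m acts on {0, ..., m-1}; the word of a permutation has letters 1, ..., m.
   Words have letters in int. *)
Definition word (m : nat) (u : 'S_m) : seq int :=
  [seq (u i : nat)%:Z + 1 | i : 'I_m].

Definition forms (c : nat) (x : seq int) (u : 'S_c) : Prop :=
  exists k : int, x = [seq y + k | y <- word u].

(* The first k letters of x are its k smallest letters. *)
Definition is_tail (x : seq int) (k : nat) : bool :=
  perm_eq (take k x) (take k (sort <=%O x)).

Fact tail_exists (x : seq int) : exists k, (0 < k)%N && is_tail x k.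
Proof.
exists (size x).+1.
by rewrite /is_tail !take_oversize ?size_sort //= perm_sym perm_sort.
Qed.

Definition tail_size (x : seq int) : nat := ex_minn (tail_exists x).

Definition right_leaning (x : seq int) : bool := (tail_size x < size x)%N.
Definition left_leaning (x : seq int) : bool := (tail_size (rev x) < size x)%N.
Definition omni_leaning (x : seq int) : bool :=
  ~~ right_leaning x && ~~ left_leaning x.

Definition omni_perms (c : nat) : {set 'S_c} :=
  [set u : 'S_c | omni_leaning (word u)].

(* A hit is designated by the (0-based) position i of its first letter. *)
Definition subword (c i : nat) (x : seq int) : seq int := take c (drop i x).

(* The word x in which the subword of length c at position i is replaced by the
   average of its letters, which then sits at position i. *)
Definition collapse (c i : nat) (x : seq int) : seq rat :=
  [seq z%:Q | z <- take i x]
  ++ (\sum_(z <- subword c i x) z)%:Q / c%:R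
  :: [seq z%:Q | z <- drop (i + c) x].

(* Position of the neighbour of position i of y that is closest in value, the
   left one in case of a tie; meaningful only if 1 < size y. *)
Definition nearest (y : seq rat) (i : nat) : nat :=
  if i == 0%N then 1%N
  else if i.+1 == size y then i.-1
  else if `|y`_i.-1 - y`_i| <= `|y`_i.+1 - y`_i| then i.-1 else i.+1.

Definition right_polarized (c i : nat) (x : seq int) : bool :=
  let y := collapse c i x in let j := nearest y i in
  (size x != c) && (y`_(minn i j) < y`_(maxn i j)).

Definition left_polarized (c i : nat) (x : seq int) : bool :=
  let y := collapse c i x in let j := nearest y i in
  (size x == c) || (y`_(minn i j) > y`_(maxn i j)).

Definition backward (c i : nat) (x : seq int) : bool :=
  let h := subword c i x in
  [|| right_polarized c i x && left_leaning h,
      left_polarized c i x && right_leaning h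
    | omni_leaning h].

Definition forward (c i : nat) (x : seq int) : bool := ~~ backward c i x.

Section Straightening.

Variables (c n : nat) (P : {set {set 'S_c}}) (C : {set 'S_c}).

Definition hit_in (D : {set 'S_c}) (i : nat) (w : 'S_n) : Prop :=
  (i + c <= n)%N /\ exists2 u, u \in D & forms (subword c i (word w)) u.

Definition P_hit (i : nat) (w : 'S_n) : Prop :=
  exists2 B, B \in P & hit_in B i w.

Definition P_rearrangement (i : nat) (w w' : 'S_n) : Prop :=
  [/\ take i (word w') = take i (word w),
      drop (i + c) (word w') = drop (i + c) (word w),
      perm_eq (subword c i (word w')) (subword c i (word w))
    & exists2 B, B \in P & hit_in B i w /\ hit_in B i w'].

Definition straightened (i : nat) (w : 'S_n) : Prop :=
  hit_in C i w /\
  (forward c i (word w) \/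
   backward c i (word w) /\
   ~ exists2 w', P_rearrangement i w w' & forward c i (word w')).

Definition straightening (w w' : 'S_n) : Prop :=
  exists i, [/\ P_hit i w, ~ straightened i w,
                P_rearrangement i w w' & straightened i w'].

(* The cardinals below are 0 or 1, according to the boolean on the right. *)
Definition straightening_set : Prop :=
  C \subset cover P /\
  forall B, B \in P ->
    [/\ #|[set u in C :&: B | left_leaning (word u)]|
          = [exists u in B, left_leaning (word u)] :> nat,
        #|[set u in C :&: B | right_leaning (word u)]|
          = [exists u in B, right_leaning (word u)] :> nat
      & #|[set u in C :&: B | omni_leaning (word u)]|
          = [forall u in B, omni_leaning (word u)] :> nat].

End Straightening.

(* The components of (A, R) are the classes of the equivalence generated by R. *)
Definition confluent (A : finType) (R : A -> A -> Prop) : Prop :=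
  (forall a b, clos_refl_trans A R a b -> clos_refl_trans A R b a -> a = b) /\
  (forall x0, exists! m, clos_refl_sym_trans A R x0 m /\
     forall x, clos_refl_sym_trans A R x0 x -> clos_refl_trans A R x m).

(* C-confluence of P only makes sense when C is a straightening set of P, so
   this is part of the assertion. *)
Definition C_confluent (c n : nat) (P : {set {set 'S_c}}) (C : {set 'S_c}) :
    Prop :=
  straightening_set P C /\ confluent (@straightening c n P C).

(* Main.v *)
(** If two distinct hits overlap, their common letters are consecutive in value,
so they are the smallest or the largest letters of each hit, and both hits lean.
Hence a hit forming the omni leaning [o] is disjoint from every other hit.
Moreover, rearranging a hit does not affect the polarization of a disjoint one:
the rearranged letters stay on the same side of its average and of its other
neighbour. So straightenings at disjoint hits commute.

A hit forming [o] is always backward. If [{o}] is a new part, such hits are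
already straightened, and the straightening relation does not change at all.
If [o] joins a part of [P], the new relation adds the straightenings of hits
forming [o]. These hits are never created and disappear once straightened, so
the new relation is acyclic. It is locally confluent: two old steps are joined
by the confluence of [P], and a new step commutes with every step at another
position, while the result of straightening a given hit is unique. Newman's
lemma concludes. *)

Require Import Defs.
From mathcomp Require Import all_boot all_order all_algebra all_fingroup.
From mathcomp Require Import boolp zify.
From Stdlib Require Import Relation_Operators Operators_Properties.
From Stdlib Require Relations_3_facts.

Set Implicit Arguments.
Unset Strict Implicit.
Unset Printing Implicit Defensive.

Import Order.TTheory GRing.Theory Num.Theory.
Local Open Scope ring_scope.

(** * Newman's lemma for finite acyclic relations *)

Section FiniteRewriting.

Variables (A : finType) (R : A -> A -> Prop).
Hypothesis R_irr : forall a, ~ R a a.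
Hypothesis R_anti : forall a b,
  clos_refl_trans A R a b -> clos_refl_trans A R b a -> a = b.
Hypothesis R_loc : forall a b c, R a b -> R a c ->
  exists2 d, clos_refl_trans A R b d & clos_refl_trans A R c d.

Local Notation "a ->* b" := (clos_refl_trans A R a b) (at level 70).

Lemma Rstar_clos_refl_trans a b : Relations_2.Rstar A R a b <-> a ->* b.
Proof.
split.
  elim=> {a b} [x|x y z xy _ IH]; first exact: rt_refl.
  by apply: rt_trans IH; apply: rt_step.
move/clos_rt_rt1n_iff; elim=> {a b} [x|x y z xy _ IH].
  exact: Relations_2.Rstar_0.
exact: Relations_2.Rstar_n xy IH.
Qed.

(** The set of points reachable from [a] shrinks strictly along a step, since [R_anti] and [R_irr]
    forbid a way back to [a]. The induction is on its cardinal. *)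
Lemma acyclic_noetherian : Relations_3.Noetherian A R.
Proof.
pose reach (a : A) : {set A} := [set b | `[< a ->* b >]].
move=> a; have [n] := ubnP #|reach a|; elim: n a => [|n IHn] a;
  first by rewrite ltn0.
rewrite ltnS => le_an.
constructor=> b ab; apply: IHn; apply: leq_trans le_an; apply: proper_card.
apply/properP; split.
  apply/subsetP=> d; rewrite !inE => /asboolP bd; apply/asboolP.
  by apply: rt_trans bd; apply: rt_step.
exists a; rewrite inE; first by apply/asboolP; apply: rt_refl.
apply/asboolP=> ba; case: (@R_irr a).
by rewrite {2}(R_anti (rt_step _ _ _ _ ab) ba).
Qed.

(** Newman's lemma joins any two paths with a common source. A zigzag is then closed by induction,
    two joins being glued at their shared endpoint. *)
Lemma church_rosser a b : clos_refl_sym_trans A R a b ->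
  exists2 d, a ->* d & b ->* d.
Proof.
have conf : Relations_3.Confluent A R.
  apply: Relations_3_facts.Newman acyclic_noetherian _ => x y z xy xz.
  have [d yd zd] := R_loc xy xz.
  by exists d; split; apply/Rstar_clos_refl_trans.
elim=> {a b} [a b ab|a|a b _ [d ad bd]|a b e _ [d ad bd] _ [f bf ef]].
- by exists b; [apply: rt_step | apply: rt_refl].
- by exists a; apply: rt_refl.
- by exists d.
have [g []] := conf b d f (proj2 (Rstar_clos_refl_trans _ _) bd)
                          (proj2 (Rstar_clos_refl_trans _ _) bf).
move=> /Rstar_clos_refl_trans dg /Rstar_clos_refl_trans fg.
by exists g; [apply: rt_trans dg | apply: rt_trans fg].
Qed.

Lemma normal_form a : exists2 m, a ->* m & forall b, m ->* b -> b = m.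
Proof.
elim: (acyclic_noetherian a) => {}a _ IHa.
have [[b ab]|nR] := pselect (exists b, R a b).
  have [m bm nm] := IHa b ab; exists m => //.
  by apply: rt_trans bm; apply: rt_step.
exists a; first exact: rt_refl.
move=> b /clos_rt_rt1n_iff ab.
by case: ab nR => // y z ay _ []; exists y.
Qed.

(** By Church-Rosser the whole component of [a] reaches the normal form of [a]. Any rival sink is
    reached from that normal form, hence equal to it. *)
Lemma newman_confluent : confluent R.
Proof.
split=> // a; have [m am nm] := normal_form a; exists m; split=> [|m'].
  split=> [|b ab]; first exact: clos_rt_clos_rst.
  have [d bd md] : exists2 d, b ->* d & m ->* d.
    apply: church_rosser; apply: rst_trans (rst_sym _ _ _ _ ab) _.
    exact: clos_rt_clos_rst.
  by rewrite -(nm d md).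
move=> [am' m'P]; apply/esym/nm/m'P; exact: clos_rt_clos_rst.
Qed.

End FiniteRewriting.

(** * Words and leaning *)

(** Sorting acts separately on the two blocks cut by the threshold [t], so [d] is a candidate in the
    minimum defining [tail_size]. *)
Lemma right_leaning_split (x : seq int) d (t : int) : (0 < d < size x)%N ->
  all (<= t) (take d x) -> all (> t) (drop d x) -> right_leaning x.
Proof.
case/andP=> d0 dx le_t gt_t; have le_dx := ltnW dx;
  rewrite /right_leaning /tail_size.
case: ex_minnP => m _ min_m; apply: leq_ltn_trans dx; apply: min_m.
rewrite d0 /is_tail -{2}(cat_take_drop d x) /=.
have -> : sort <=%O (take d x ++ drop d x)
    = sort <=%O (take d x) ++ sort <=%O (drop d x).
  apply: (sorted_eq le_trans le_anti (sort_sorted le_total _)).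
    rewrite sorted_pairwise; last exact: le_trans.
    rewrite pairwise_cat -!sorted_pairwise; try exact: le_trans.
    rewrite !sort_sorted ?andbT; try exact: le_total.
    apply/allrelP=> y z; rewrite !mem_sort => /(allP le_t) yt /(allP gt_t) tz.
    exact/ltW/(le_lt_trans yt).
  rewrite perm_sort.
  by apply: perm_cat; rewrite perm_sym perm_sort.
rewrite (@take_size_cat _ _ (sort _ _)) ?size_sort ?size_takel ?le_dx //.
by rewrite perm_sym perm_sort.
Qed.

Lemma left_leaning_split (x : seq int) d (t : int) : (0 < d < size x)%N ->
  all (> t) (take d x) -> all (<= t) (drop d x) -> left_leaning x.
Proof.
move=> dx gt_t le_t; rewrite /left_leaning -(size_rev x).
apply: (@right_leaning_split _ (size x - d) t); rewrite ?size_rev.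
- by lia.
- by rewrite take_rev all_rev subKn //; lia.
- by rewrite drop_rev all_rev subKn //; lia.
Qed.

Lemma tail_size_shift (x : seq int) (k : int) :
  tail_size [seq y + k | y <- x] = tail_size x.
Proof.
rewrite /tail_size; apply: eq_ex_minn => d; congr (_ && _); rewrite /is_tail.
have leD : (relpre (fun y : int => y + k) <=%O : rel int) = <=%O.
  by apply/funext=> y; apply/funext=> z /=; rewrite lerD2r.
rewrite sort_map leD -!map_take; apply/idP/idP=> [|/perm_map]; last exact.
by apply: perm_map_inj; apply: addIr.
Qed.

Lemma right_leaning_shift (x : seq int) (k : int) :
  right_leaning [seq y + k | y <- x] = right_leaning x.
Proof. by rewrite /right_leaning tail_size_shift size_map. Qed.

Lemma left_leaning_shift (x : seq int) (k : int) :
  left_leaning [seq y + k | y <- x] = left_leaning x.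
Proof. by rewrite /left_leaning -map_rev tail_size_shift size_map. Qed.

Lemma ler_dist_below (a l r : rat) :
  l < a -> r < a -> (`|l - a| <= `|r - a|) = (r <= l).
Proof. by move=> la ra; rewrite !ltr0_norm ?subr_lt0 // lerN2 lerD2r. Qed.

Lemma ler_dist_above (a l r : rat) :
  a < l -> a < r -> (`|l - a| <= `|r - a|) = (l <= r).
Proof. by move=> al ar; rewrite !gtr0_norm ?subr_gt0 // lerD2r. Qed.

Lemma sum_bounds (s : seq int) (lo hi : int) : all (fun z => lo <= z <= hi) s ->
  lo * (size s)%:Z <= \sum_(z <- s) z <= hi * (size s)%:Z.
Proof.
elim: s => [|z s IHs] /=; first by rewrite big_nil !mulr0 lexx.
move=> /andP[/andP[lz zh] /IHs/andP[ls sh]].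
by rewrite big_cons intS !mulrDr !mulr1 !lerD.
Qed.

(** Form in which the cardinals of [straightening_set] are used: a cardinal equal to a boolean is at
    most 1. *)
Lemma card_le1_eq (T : finType) (a : pred T) (A : {set T}) (b : bool) u v :
  #|[set t in A | a t]| = b :> nat -> u \in A -> v \in A -> a u -> a v -> u = v.
Proof.
move=> card_a uA vA au av.
have /card_le1_eqP : (#|[set t in A | a t]| <= 1)%N by rewrite card_a leq_b1.
by apply; rewrite inE ?uA ?vA.
Qed.

Lemma size_word m (u : 'S_m) : size (word u) = m.
Proof. by rewrite size_map size_enum_ord. Qed.

Lemma nth_word m (u : 'S_m) (i : 'I_m) : (word u)`_i = (u i : nat)%:Z + 1.
Proof. by rewrite (nth_map i) ?size_enum_ord // nth_ord_enum. Qed.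

Lemma perm_eq_word m (u v : 'S_m) : perm_eq (word u) (word v).
Proof.
suff H (t : 'S_m) : perm_eq (word t) [seq (i : nat)%:Z + 1 | i : 'I_m].
  by apply: perm_trans (H u) _; rewrite perm_sym.
rewrite /word /image_mem (map_comp (fun i : 'I_m => (i : nat)%:Z + 1) t).
apply: perm_map; apply: uniq_perm; rewrite ?enum_uniq //.
  by rewrite map_inj_uniq ?enum_uniq //; apply: perm_inj.
by move=> i; rewrite mem_enum -{1}(permKV t i) mem_map ?mem_enum //;
  apply: perm_inj.
Qed.

(** * Hits and rearrangements *)

(** Used both for positions, with [i] the start of a hit, and for 0-based values, with [i] the least
    value of a hit. *)
Definition in_window (c i p : nat) : bool := (i <= p < i + c)%N.

Section Windows.

Variables c n : nat.
Hypothesis c_gt0 : (0 < c)%N.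
Implicit Types (i j : nat) (w x y : 'S_n) (u v : 'S_c).

Definition agree_off i w w' : Prop :=
  forall p : 'I_n, ~~ in_window c i p -> w p = w' p.

Definition agree_on i w w' : Prop :=
  forall p : 'I_n, in_window c i p -> w p = w' p.

Definition disjoint_windows i j : bool := (i + c <= j)%N || (j + c <= i)%N.

Lemma disjoint_windows_sym i j : disjoint_windows i j = disjoint_windows j i.
Proof. by rewrite /disjoint_windows orbC. Qed.

Lemma disjoint_windowsP i j p :
  disjoint_windows i j -> in_window c i p -> ~~ in_window c j p.
Proof. rewrite /disjoint_windows /in_window; lia. Qed.

Lemma agree_off_sym i w w' : agree_off i w w' -> agree_off i w' w.
Proof. by move=> H p /H. Qed.

Lemma agree_off_trans i w x y :
  agree_off i w x -> agree_off i x y -> agree_off i w y.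
Proof. by move=> wx xy p pi; rewrite wx ?xy. Qed.

Lemma nth_word_eq w w' (p : 'I_n) : (word w)`_p = (word w')`_p <-> w p = w' p.
Proof.
rewrite !nth_word; split=> [/addIr[] /val_inj //|->//].
Qed.

Lemma subword_eqP i w w' : (i + c <= n)%N ->
  subword c i (word w) = subword c i (word w') <-> agree_on i w w'.
Proof.
move=> icn; have sz (t : 'S_n) : size (subword c i (word t)) = c :> nat.
  by rewrite size_takel // size_drop size_word; lia.
have nt (t : 'S_n) q : (q < c)%N -> (subword c i (word t))`_q = (word t)`_(i +
  q).
  by move=> qc; rewrite nth_take // nth_drop.
split=> [E p /andP[ip pic]|E].
  apply/nth_word_eq; have := congr1 (fun s : seq int => s`_(p - i)) E.
  by rewrite !nt ?subnKC //; lia.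
apply: (@eq_from_nth _ 0); rewrite !sz // => q qc; rewrite !nt //.
have lt_q : (i + q < n)%N by lia.
have := nth_word_eq w w' (Ordinal lt_q) => /= ->; apply: E.
by rewrite /in_window /=; lia.
Qed.

Lemma agree_offP i w w' : (i + c <= n)%N ->
  agree_off i w w' <-> take i (word w') = take i (word w) /\
    drop (i + c) (word w') = drop (i + c) (word w).
Proof.
move=> icn; split=> [E|[Et Ed] p].
  split; apply: (@eq_from_nth _ 0); rewrite ?size_take ?size_drop ?size_word //.
    move=> q; case: ifP => [_ qi|]; last by lia.
    have lt_q : (q < n)%N by lia.
    rewrite !nth_take //; apply/(nth_word_eq w' w (Ordinal lt_q)).
    by rewrite E // /in_window /=; lia.
  move=> q lt_q; rewrite !nth_drop.
  have lt_q' : (i + c + q < n)%N by lia.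
  apply/(nth_word_eq w' w (Ordinal lt_q')).
  by rewrite E // /in_window /=; lia.
rewrite /in_window negb_and -ltnNge -leqNgt => /orP[pi|pic].
  apply/esym/nth_word_eq; have := congr1 (fun s : seq int => s`_p) Et.
  by rewrite !nth_take.
apply/esym/nth_word_eq; have := congr1 (fun s : seq int => s`_(p - (i + c))) Ed.
by rewrite !nth_drop subnKC.
Qed.

(** Both words have the same letters, and their common prefix and suffix cancel. *)
Lemma agree_off_perm_eq i w w' : (i + c <= n)%N -> agree_off i w w' ->
  perm_eq (subword c i (word w')) (subword c i (word w)).
Proof.
move=> icn /agree_offP[] // Et Ed; have E := perm_eq_word w' w.
have split3 (t : 'S_n) : word t = take i (word t) ++ subword c i (word t)
    ++ drop (i + c) (word t).
  by rewrite /subword addnC -drop_drop cat_take_drop cat_take_drop.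
by move: E; rewrite {1}(split3 w) {1}(split3 w') Et Ed perm_cat2l perm_cat2r.
Qed.

Lemma agree_on_off i w w' : agree_on i w w' -> agree_off i w w' -> w = w'.
Proof. by move=> on off; apply/permP=> p;
  case: (boolP (in_window c i p)) => [/on|/off]. Qed.

Lemma transport i j w w' y : disjoint_windows i j ->
  agree_off i w w' -> agree_off j w y ->
  exists y', [/\ agree_off i y y', agree_off j w' y',
    agree_on i w' y' & agree_on j y y'].
Proof.
(* Products act left factor first, so [w' * w^-1] is the permutation of positions that turns [w]
   into [w']. It moves only positions of window [i], where [w] and [y] agree, so it makes the same
   change in [y]. *)
move=> dij ww' wy; pose y' : 'S_n := (w' * w^-1 * y)%g; exists y'.
have off (p : 'I_n) : ~~ in_window c i p -> y' p = y p.
  by move=> pi; rewrite !permM -ww' // permK.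
have on (p : 'I_n) : in_window c i p -> y' p = w' p.
  move=> pi; rewrite !permM; set q : 'I_n := (w^-1)%g (w' p).
  have wq : w q = w' p by rewrite permKV.
  have qi : in_window c i q.
    apply/negPn/negP=> qi; move: wq; rewrite ww' // => /perm_inj qp.
    by rewrite qp pi in qi.
  by rewrite -wy // (disjoint_windowsP dij).
split=> [p pi|p pj|p pi|p pj].
- by rewrite off.
- have [/on //|pi] := boolP (in_window c i p); by rewrite off // -wy // ww'.
- by rewrite on.
by rewrite off // (disjoint_windowsP _ pj) // disjoint_windows_sym.
Qed.

(** What remains of a hit when its pattern is forgotten: its letters are [k + 1], ..., [k + c], as
    [w p] is 0-based. Rearranging the hit preserves this. *)
Definition hit_interval i w k : Prop :=
  [/\ (i + c <= n)%N, (k + c <= n)%N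
    & forall p : 'I_n, in_window c i p = in_window c k (w p)].

Lemma formsP i w u : (i + c <= n)%N -> forms (subword c i (word w)) u ->
  exists k, forall (q : 'I_c) (p : 'I_n), p = (i + q)%N :> nat ->
    w p = (k + u q)%N :> nat.
Proof.
move=> icn [k E]; have wE (q : 'I_c) (p : 'I_n) : p = (i + q)%N :> nat ->
    (w p : nat)%:Z = (u q : nat)%:Z + k.
  move=> pq; have := congr1 (fun s : seq int => s`_q) E.
  rewrite nth_take // nth_drop -pq nth_word (nth_map 0) ?size_word // nth_word.
  lia.
(* The least value of the hit sits at [q0], where [u] is 0. It serves as the shift, now a natural
   number. *)
pose q0 := (u^-1)%g (Ordinal c_gt0).
have lt_q0 : (i + q0 < n)%N by have := ltn_ord q0; lia.
have := wE q0 (Ordinal lt_q0) erefl; rewrite permKV /= => k0.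
exists (w (Ordinal lt_q0)) => q p pq; have := wE q p pq; lia.
Qed.

Lemma forms_hit_interval i w u : (i + c <= n)%N ->
  forms (subword c i (word w)) u -> exists2 k, hit_interval i w k &
    forall (q : 'I_c) (p : 'I_n), p = (i + q)%N :> nat ->
      w p = (k + u q)%N :> nat.
Proof.
move=> icn /formsP-/(_ icn)[k E]; exists k => //; split=> // [|p].
  have ltc1 : (c.-1 < c)%N by rewrite prednK.
  pose q := (u^-1)%g (Ordinal ltc1).
  have lt_q : (i + q < n)%N by have := ltn_ord q; lia.
  have := E q (Ordinal lt_q) erefl; rewrite permKV /= => k1.
  by have := ltn_ord (w (Ordinal lt_q)); lia.
apply/idP/idP=> [/andP[ip pic]|/andP[kp pkc]].
  have lt_q : (p - i < c)%N by lia.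
  have -> : w p = (k + u (Ordinal lt_q))%N :> nat by apply: E => /=; lia.
  by rewrite /in_window; have := ltn_ord (u (Ordinal lt_q)); lia.
have lt_v : (w p - k < c)%N by lia.
(* The value [w p] already occurs inside the window, at offset [q]; injectivity of [w] puts [p]
   there. *)
pose q := (u^-1)%g (Ordinal lt_v).
have lt_q : (i + q < n)%N by have := ltn_ord q; lia.
have := E q (Ordinal lt_q) erefl;
  rewrite permKV /= subnKC // => /val_inj/perm_inj <-.
by rewrite /in_window /=; have := ltn_ord q; lia.
Qed.

Lemma size_subword i (x : seq int) : (i + c <= size x)%N ->
  size (subword c i x) = c.
Proof. by move=> icx; rewrite size_takel // size_drop; lia. Qed.

Lemma nth_subword i (x : seq int) q : (q < c)%N ->
  (subword c i x)`_q = x`_(i + q).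
Proof. by move=> qc; rewrite nth_take // nth_drop. Qed.

(** * Overlaps of windows and of value intervals *)

Lemma all_take_subword (a : pred int) i d w : (i + c <= n)%N -> (d <= c)%N ->
  (forall p : 'I_n, (i <= p < i + d)%N -> a ((w p : nat)%:Z + 1)) ->
  all a (take d (subword c i (word w))).
Proof.
move=> icn dc aw; apply/(all_nthP 0) => q.
rewrite size_takel ?size_subword ?size_word // => qd.
have lt_q : (i + q < n)%N by lia.
rewrite nth_take // nth_subword ?(leq_trans qd) //.
by rewrite (nth_word w (Ordinal lt_q)); apply: aw => /=; lia.
Qed.

Lemma all_drop_subword (a : pred int) i d w : (i + c <= n)%N -> (d <= c)%N ->
  (forall p : 'I_n, (i + d <= p < i + c)%N -> a ((w p : nat)%:Z + 1)) ->
  all a (drop d (subword c i (word w))).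
Proof.
move=> icn dc aw; apply/(all_nthP 0) => q.
rewrite size_drop size_subword ?size_word // => qd.
have lt_q : (i + (d + q) < n)%N by lia.
rewrite nth_drop nth_subword; last by lia.
by rewrite (nth_word w (Ordinal lt_q)); apply: aw => /=; lia.
Qed.

(** If the windows overlap, the shared positions form a proper prefix or suffix of window [i]. They
    carry the values shared by the two intervals, which are the smallest or the largest of the hit.
    Each of the four combinations makes the hit lean. *)
Lemma omni_disjoint i j w k l : i != j ->
  hit_interval i w k -> hit_interval j w l ->
  omni_leaning (subword c i (word w)) -> disjoint_windows i j.
Proof.
move=> neq_ij [icn kcn wi] [jcn lcn wj] /andP[/negP not_right /negP not_left].
apply: contraT; rewrite negb_or -!ltnNge => /andP[lt_ji lt_ij].
have ssz : size (subword c i (word w)) = c by rewrite size_subword ?size_word.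
have w_ij (p : 'I_n) : in_window c i p -> in_window c k (w p) /\
    (in_window c j p = in_window c l (w p)) by rewrite wj wi.
have [lt_kl|lt_lk|eq_kl] := ltngtP k l; last first.
(* Equal value intervals would force equal windows, against [i != j]. *)
- have lt_i : (i < n)%N by lia.
  have lt_j : (j < n)%N by lia.
  have := wi (Ordinal lt_i); have := wj (Ordinal lt_i).
  have := wi (Ordinal lt_j); have := wj (Ordinal lt_j).
  rewrite eq_kl /in_window /= => <- + <-; lia.
(* Here [l < k]: the shared letters are the smallest of the hit, those at most [l + c], a letter
   being a value plus 1. *)
- case: (ltngtP i j) neq_ij => // [i_lt_j|j_lt_i] _.
    exfalso; apply: not_left; apply: (@left_leaning_split _ (j - i) (l + c)%:Z).
    - by rewrite ssz; lia.
    - apply: all_take_subword => // [|p pij]; first by lia.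
      have [|] := w_ij p; rewrite /in_window /=; lia.
    apply: all_drop_subword => // [|p pij]; first by lia.
    have [|] := w_ij p; rewrite /in_window /=; lia.
  exfalso; apply: not_right;
    apply: (@right_leaning_split _ (j + c - i) (l + c)%:Z).
  - by rewrite ssz; lia.
  - apply: all_take_subword => // [|p pij]; first by lia.
    have [|] := w_ij p; rewrite /in_window /=; lia.
  apply: all_drop_subword => // [|p pij]; first by lia.
  have [|] := w_ij p; rewrite /in_window /=; lia.
(* Here [k < l]: the shared letters are the largest of the hit, those above [l]. *)
case: (ltngtP i j) neq_ij => // [i_lt_j|j_lt_i] _.
  exfalso; apply: not_right; apply: (@right_leaning_split _ (j - i) l%:Z).
  - by rewrite ssz; lia.
  - apply: all_take_subword => // [|p pij]; first by lia.
    have [|] := w_ij p; rewrite /in_window /=; lia.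
  apply: all_drop_subword => // [|p pij]; first by lia.
  have [|] := w_ij p; rewrite /in_window /=; lia.
exfalso; apply: not_left; apply: (@left_leaning_split _ (j + c - i) l%:Z).
- by rewrite ssz; lia.
- apply: all_take_subword => // [|p pij]; first by lia.
  have [|] := w_ij p; rewrite /in_window /=; lia.
apply: all_drop_subword => // [|p pij]; first by lia.
have [|] := w_ij p; rewrite /in_window /=; lia.
Qed.

Lemma disjoint_intervals i j w k l : disjoint_windows i j ->
  hit_interval i w k -> hit_interval j w l -> disjoint_windows k l.
Proof.
move=> dij [icn kcn wi] [jcn lcn wj]; apply: contraT.
rewrite negb_or -!ltnNge => /andP[lt_lk lt_kl].
(* Overlapping value intervals share the value [maxn k l], whose position would lie in both
   windows. *)
have lt_v : (maxn k l < n)%N by lia.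
pose p := (w^-1)%g (Ordinal lt_v).
have := @disjoint_windowsP i j p dij; rewrite wi wj permKV /in_window /=; lia.
Qed.

Lemma agree_off_window i w y (p : 'I_n) (k : nat) : agree_off i w y ->
  hit_interval i w k -> in_window c i p = in_window c k (y p).
Proof.
move=> wy [icn kcn wi]; pose q := (w^-1)%g (y p).
have wq : w q = y p by rewrite permKV.
rewrite -wq -wi; have [pi|pi] := boolP (in_window c i p).
  apply/esym/contraT=> qi; move: wq; rewrite wy // => /perm_inj qp.
  by rewrite qp pi in qi.
by move: wq; rewrite -wy // => /perm_inj ->; apply/esym/negbTE.
Qed.

Lemma agree_off_interval i w y k :
  agree_off i w y -> hit_interval i w k -> hit_interval i y k.
Proof.
by move=> wy iwk; case: (iwk) => icn kcn _; split=> // p;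
  apply: agree_off_window iwk.
Qed.

Lemma agree_on_interval i w y k :
  agree_on i w y -> hit_interval i w k -> hit_interval i y k.
Proof.
move=> wy [icn kcn wi]; split=> // p; apply/idP/idP=> [pi|yk].
  by rewrite -wy // -wi.
pose q := (w^-1)%g (y p); have wq : w q = y p by rewrite permKV.
have qi : in_window c i q by rewrite wi wq.
by move: wq; rewrite wy // => /perm_inj <-.
Qed.

Lemma disjoint_agree_on i j w y : disjoint_windows i j -> agree_off j w y ->
  agree_on i w y.
Proof. by move=> dij wy p pi; apply: wy; apply: disjoint_windowsP pi. Qed.

(** * Polarization *)

Section Collapse.

Variables (x : seq int) (i : nat).
Hypothesis icx : (i + c <= size x)%N.
Let a : rat := (collapse c i x)`_i.

Let le_ix : (i <= size x)%N.
Proof. exact: leq_trans (leq_addr c i) icx. Qed.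

Lemma size_collapse : size (collapse c i x) = (size x - c).+1.
Proof. by rewrite size_cat /= !size_map size_takel ?size_drop; lia. Qed.

Lemma nth_collapse_prev : (0 < i)%N ->
  (collapse c i x)`_i.-1 = (x`_i.-1)%:~R.
Proof.
move=> i0; have lt_i : (i.-1 < i)%N by rewrite prednK.
rewrite nth_cat size_map size_takel // lt_i.
by rewrite (nth_map 0) ?size_takel ?nth_take.
Qed.

Lemma nth_collapse : a = (\sum_(z <- subword c i x) z)%:~R / c%:R.
Proof. by rewrite /a nth_cat size_map size_takel ?ltnn ?subnn. Qed.

Lemma nth_collapse_next : (i + c < size x)%N ->
  (collapse c i x)`_i.+1 = (x`_(i + c))%:~R.
Proof.
move=> icx'; rewrite nth_cat size_map size_takel //.
rewrite ltnNge leqnSn /= subSnn /= (nth_map 0) ?size_drop ?subn_gt0 //.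
by rewrite nth_drop addn0.
Qed.

(* The threshold [t] separates the neighbours [L] and [R] below the average of
   the hit from those above it. When both neighbours are on the same side of the
   average, [R <= L] decides which one is nearest. *)
Definition right_polarized_by (t : int) (L R : int) : bool :=
  if i == 0%N then t < R else if (i + c)%N == size x then L <= t else
  if L <= t then (t < R) || (R <= L) else (t < R) && (R < L).

(** Replaces comparisons with the rational average by comparisons of integers with [t]. The
    neighbours never equal the average, so the two polarizations are complementary. *)
Lemma polarizedE (t : int) :
  (forall z : int, z <= t -> z%:~R < a) ->
  ((0 < i)%N -> t < x`_i.-1 -> a < (x`_i.-1)%:~R) ->
  ((i + c < size x)%N -> t < x`_(i + c) -> a < (x`_(i + c))%:~R) ->
  right_polarized c i x
    = (size x != c) && right_polarized_by t x`_i.-1 x`_(i + c) /\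
  left_polarized c i x = ~~ right_polarized c i x.
Proof.
move=> lt_a gt_aL gt_aR.
rewrite /left_polarized /right_polarized /right_polarized_by /nearest.
rewrite size_collapse; have [//|neq_xc] := eqVneq (size x) c; rewrite /=.
have [i0|i_neq0] := eqVneq i 0%N.
  have -> : minn i 1 = i by lia.
  have -> : maxn i 1 = i.+1 by lia.
  rewrite nth_collapse_next -/a; last by lia.
  case: (leP x`_(i + c) t) => [/lt_a|/gt_aR] H; last first.
    by have {}H := H ltac:(lia); rewrite H ltNge ltW.
  by rewrite H ltNge ltW.
have -> : (i.+1 == (size x - c).+1) = (i + c == size x)%N by lia.
have min_pred : minn i i.-1 = i.-1 by lia.
have max_pred : maxn i i.-1 = i by lia.
case: (eqVneq (i + c)%N (size x)) => [_|neq_icx].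
  rewrite min_pred max_pred nth_collapse_prev -/a; last by lia.
  case: (leP x`_i.-1 t) => [/lt_a|/gt_aL] H; last first.
    by have {}H := H ltac:(lia); rewrite H ltNge ltW.
  by rewrite H ltNge ltW.
rewrite -/a nth_collapse_prev ?nth_collapse_next; try by lia.
have min_succ : minn i i.+1 = i by lia.
have max_succ : maxn i i.+1 = i.+1 by lia.
have {}gt_aL := gt_aL ltac:(lia); have {}gt_aR := gt_aR ltac:(lia).
case: ifP => cmp; rewrite ?min_pred ?max_pred ?min_succ ?max_succ -/a;
  rewrite ?nth_collapse_prev ?nth_collapse_next; try by lia.
all: case: (leP x`_i.-1 t) cmp => [/lt_a|/gt_aL] HL;
  case: (leP x`_(i + c) t) => [/lt_a|/gt_aR] HR;
  rewrite ?HL ?HR ?(lt_gtF HL) ?(lt_gtF HR) //=.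
- by rewrite (ler_dist_below HL HR) ler_int => ->.
- by rewrite (ler_dist_above HL HR) ler_int leNgt => /negbTE ->.
- by rewrite (ler_dist_below HL HR) ler_int => ->.
by rewrite (ler_dist_above HL HR) ler_int leNgt => /negbFE ->.
Qed.

End Collapse.

Lemma hit_mean_bounds i w k : hit_interval i w k ->
  (k%:Z + 1)%:~R <= (collapse c i (word w))`_i <= (k%:Z + c%:Z)%:~R.
Proof.
case=> icn kcn wi; rewrite nth_collapse ?size_word //.
have /sum_bounds : all (fun z : int => k%:Z + 1 <= z <= k%:Z + c%:Z)
    (subword c i (word w)).
  rewrite -[subword _ _ _]take_size size_subword ?size_word //.
  by apply: all_take_subword => // p;
    rewrite -[(_ <= _ < _)%N]/(in_window c i p)
    wi /in_window; lia.
rewrite size_subword ?size_word // => /andP[lo hi].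
have c0 : 0 < c%:R :> rat by rewrite ltr0n.
rewrite ler_pdivlMr // ler_pdivrMr // -[c%:R]/((c%:Z)%:~R).
by rewrite -!intrM !ler_int lo hi.
Qed.

(** The threshold [k] works: the average lies between [k + 1] and [k + c], while a letter outside
    the hit is at most [k] or above [k + c]. *)
Lemma hit_polarizedE i w k : hit_interval i w k ->
  right_polarized c i (word w) = (n != c) &&
    right_polarized_by (word w) i k%:Z (word w)`_i.-1 (word w)`_(i + c) /\
  left_polarized c i (word w) = ~~ right_polarized c i (word w).
Proof.
move=> iwk; have [icn kcn wi] := iwk.
have /andP[lo hi] := hit_mean_bounds iwk.
have above (p : 'I_n) : ~~ in_window c i p -> k%:Z < (word w)`_p ->
    (collapse c i (word w))`_i < ((word w)`_p)%:~R.
  move=> pi kp; apply: le_lt_trans hi _; rewrite ltr_int.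
  by move: pi kp; rewrite wi /in_window nth_word; lia.
have := @polarizedE (word w) i; rewrite size_word => /(_ icn k%:Z).
apply=> [z zk|i0|icn'].
- by apply: lt_le_trans lo; rewrite ltr_int ltzD1.
- have lt_p : (i.-1 < n)%N by lia.
  by apply: (above (Ordinal lt_p)); rewrite /in_window /=; lia.
by apply: (above (Ordinal icn')); rewrite /in_window /=; lia.
Qed.

Lemma left_polarizedE i w k : hit_interval i w k ->
  left_polarized c i (word w) = ~~ right_polarized c i (word w).
Proof. by case/hit_polarizedE. Qed.

Lemma collapse_agree_off i w y : (i + c <= n)%N -> agree_off i w y ->
  collapse c i (word y) = collapse c i (word w).
Proof.
move=> icn wy; have /agree_offP[//|Et Ed] := wy.
by rewrite /collapse Et Ed (perm_big _ (agree_off_perm_eq icn wy)).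
Qed.

Lemma right_polarized_agree_off i w y : (i + c <= n)%N -> agree_off i w y ->
  right_polarized c i (word y) = right_polarized c i (word w).
Proof.
by move=> icn wy; rewrite /right_polarized (collapse_agree_off icn wy)
  !size_word.
Qed.

(** A neighbour of the hit at [i] that changes stays in the value interval of [l], which is disjoint
    from that of [k], so it stays on the same side of the average. The other neighbour is outside
    the interval of [l], so the order of the two neighbours is kept as well. *)
Lemma right_polarized_disjoint i j w y k l : disjoint_windows i j ->
  hit_interval i w k -> hit_interval j w l -> agree_off j w y ->
  right_polarized c i (word y) = right_polarized c i (word w).
Proof.
move=> dij iwk jwl wy.
have iyk := agree_on_interval (disjoint_agree_on dij wy) iwk.
have jyl := agree_off_interval wy jwl.
have [[icn kcn wi] [jcn lcn wj]] := (iwk, jwl).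
have [[_ _ yi] [_ _ yj]] := (iyk, jyl).
have dkl := disjoint_intervals dij iwk jwl.
have [-> _] := hit_polarizedE iwk; have [-> _] := hit_polarizedE iyk.
congr (_ && _); rewrite /right_polarized_by !size_word.
have nbr (p : 'I_n) : ~~ in_window c i p ->
    [/\ ~~ in_window c k (w p), ~~ in_window c k (y p)
      & (in_window c j p /\ in_window c l (w p) /\ in_window c l (y p)) \/
        (~~ in_window c j p /\ ~~ in_window c l (w p) /\ w p = y p :> nat)].
  move=> pi; split; rewrite -?wi -?yi //.
  have [pj|pj] := boolP (in_window c j p); [left|right].
    by rewrite -wj -yj pj.
  by rewrite -wj; split=> //; split=> //; rewrite wy.
have out_next : ~~ in_window c i (i + c) by rewrite /in_window; lia.
have out_prev : (0 < i)%N -> ~~ in_window c i i.-1 by rewrite /in_window; lia.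
move: dij dkl; rewrite /disjoint_windows => dij dkl.
have [i0|i_neq0] := eqVneq i 0%N.
  have [->|neq_icn] := eqVneq (i + c)%N n.
    (* The hit is the whole word: the next letter is the default value on both sides. *)
    by rewrite !nth_default ?size_word.
  have lt_p : (i + c < n)%N by lia.
  have [] := nbr (Ordinal lt_p) out_next.
  by rewrite !(nth_word _ (Ordinal lt_p)) /in_window /=; lia.
have lt_p : (i.-1 < n)%N by lia.
have [] := nbr (Ordinal lt_p) (out_prev ltac:(lia)).
rewrite !(nth_word _ (Ordinal lt_p)) /=.
have [eq_icn|neq_icn] := eqVneq (i + c)%N n.
  by rewrite /in_window /=; lia.
have lt_q : (i + c < n)%N by lia.
have [] := nbr (Ordinal lt_q) out_next.
rewrite !(nth_word _ (Ordinal lt_q)) /in_window /= => wq yq qj wp yp pj.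
case: qj => -[qj [wq' yq']]; case: pj => -[pj [wp' yp']].
(* A window of length [c] cannot contain both neighbours of window [i]. *)
- by exfalso; lia.
all: by clear dij pj qj; case: ifP => ?; case: ifP => ?; lia.
Qed.

(** * Patterns formed by hits *)

Implicit Types (P : {set {set 'S_c}}) (C D : {set 'S_c}).

Lemma eq_subword i w y : (i + c <= n)%N -> agree_on i w y ->
  subword c i (word w) = subword c i (word y).
Proof. by move=> icn; case: (subword_eqP w y icn). Qed.

Lemma hit_interval_inj i w k l :
  hit_interval i w k -> hit_interval i w l -> k = l.
Proof.
case=> _ kcn wk [_ lcn wl].
have kl (r : nat) (lt_r : (r < n)%N) : in_window c k r = in_window c l r.
  by have := wl ((w^-1)%g (Ordinal lt_r)); rewrite wk permKV.
have lt_k : (k < n)%N by lia.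
have lt_l : (l < n)%N by lia.
by have := kl _ lt_k; have := kl _ lt_l; rewrite /in_window; lia.
Qed.

Lemma hit_in_interval D i w :
  hit_in D i w -> exists k, hit_interval i w k.
Proof. by case=> icn [u _ /(forms_hit_interval icn)[k iwk _]]; exists k. Qed.

Lemma hit_in_agree_on D i w y :
  agree_on i w y -> hit_in D i w -> hit_in D i y.
Proof.
by move=> wy [icn [u uD wu]]; split=> //; exists u;
  rewrite // -(eq_subword icn wy).
Qed.

Lemma forms_inj i w u v : (i + c <= n)%N ->
  forms (subword c i (word w)) u -> forms (subword c i (word w)) v -> u = v.
Proof.
move=> icn /(forms_hit_interval icn)[k iwk wu].
move=> /(forms_hit_interval icn)[l /(hit_interval_inj iwk) <- wv].
apply/permP=> q; apply/val_inj/(@addnI k).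
have lt_p : (i + q < n)%N by have := ltn_ord q; lia.
by rewrite -(wu q (Ordinal lt_p)) ?(wv q (Ordinal lt_p)).
Qed.

Lemma hit_in_agree_off i x y u : agree_off i x y ->
  hit_in [set u] i x -> hit_in [set u] i y -> x = y.
Proof.
move=> xy [icn [_ /set1P-> /(forms_hit_interval icn)[k ixk xu]]].
move=> [_ [_ /set1P-> /(forms_hit_interval icn)[l iyl yu]]].
have kl := hit_interval_inj (agree_off_interval xy ixk) iyl.
apply: agree_on_off xy => p /andP[ip pic]; apply: val_inj => /=.
have lt_q : (p - i < c)%N by lia.
by rewrite (xu (Ordinal lt_q)) ?(yu (Ordinal lt_q)) ?kl //=; lia.
Qed.

(** * Straightening at a given position *)

(** Backwardness as a function of the pattern [u] and of the polarization, [r] meaning right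
    polarized. Rearranging a hit changes [u] but not [r]. *)
Definition backward_perm (r : bool) u : bool :=
  [|| r && left_leaning (word u), ~~ r && right_leaning (word u)
    | omni_leaning (word u)].

Lemma omni_leaning_forms (s : seq int) u :
  forms s u -> omni_leaning s = omni_leaning (word u).
Proof.
by case=> k ->; rewrite /omni_leaning left_leaning_shift right_leaning_shift.
Qed.

Lemma backwardE i w u : (i + c <= n)%N -> forms (subword c i (word w)) u ->
  backward c i (word w) = backward_perm (right_polarized c i (word w)) u.
Proof.
move=> icn wu; have [k iwk _] := forms_hit_interval icn wu.
rewrite /backward (left_polarizedE iwk) (omni_leaning_forms wu).
by case: wu => t ->; rewrite left_leaning_shift right_leaning_shift.
Qed.

Lemma backward_disjoint D i j w y l : disjoint_windows i j ->
  agree_off j w y -> hit_interval j w l -> hit_in D i w ->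
  backward c i (word y) = backward c i (word w).
Proof.
move=> dij wy jwl iwD; have [k iwk] := hit_in_interval iwD.
have [icn [u _ wu]] := iwD.
have yu : forms (subword c i (word y)) u.
  by rewrite -(eq_subword icn (disjoint_agree_on dij wy)).
by rewrite (backwardE icn wu) (backwardE icn yu)
  (right_polarized_disjoint dij iwk jwl wy).
Qed.

Definition in_block P i w y : Prop :=
  exists2 B, B \in P & hit_in B i w /\ hit_in B i y.

Lemma P_hitE P i w : P_hit P i w <-> in_block P i w w.
Proof. by split=> [[B BP iwB]|[B BP [iwB _]]]; exists B. Qed.

Lemma P_rearrangementE P i w y :
  P_rearrangement P i w y <-> agree_off i w y /\ in_block P i w y.
Proof.
split=> [[Et Ed _ Bwy]|[wy Bwy]]; have [B _ [[icn _] _]] := Bwy.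
  by split=> //; apply/agree_offP.
have /agree_offP[//|Et Ed] := wy; split=> //.
exact: agree_off_perm_eq.
Qed.

Lemma in_block_agree_on P i w x w' x' : agree_on i w w' -> agree_on i x x' ->
  in_block P i w x -> in_block P i w' x'.
Proof.
move=> ww' xx' [B BP [iwB ixB]]; exists B => //.
by split; [apply: hit_in_agree_on iwB | apply: hit_in_agree_on ixB].
Qed.

(** For a backward hit, a rearrangement making it forward in [y] is carried back to [w] by
    [transport], where it is excluded. *)
Lemma straightened_disjoint P C i j w y l : disjoint_windows i j ->
  agree_off j w y -> hit_interval j w l ->
  straightened P C i w -> straightened P C i y.
Proof.
move=> dij wy jwl [iwC iw]; have wy_i := disjoint_agree_on dij wy.
split; first exact: hit_in_agree_on iwC.
rewrite /forward (backward_disjoint dij wy jwl iwC).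
case: iw => [|[bw no_fw]]; [by left | right; split=> // -[y']].
move=> /P_rearrangementE[yy' Byy'] fw; apply: no_fw.
have yw := agree_off_sym wy.
have [w' [ww' y'w' y'w'_i ww'_j]] := transport dij yy' yw.
exists w'.
  apply/P_rearrangementE; split=> //.
  by apply: in_block_agree_on Byy' => // p /wy_i.
have jy'l : hit_interval j y' l.
  apply: agree_off_interval (agree_off_sym y'w') _.
  exact: agree_on_interval ww'_j jwl.
have [B _ [_ iy'B]] := Byy'.
by rewrite /forward (backward_disjoint dij y'w' jy'l iy'B).
Qed.

Definition straightening_at P C i w y : Prop :=
  [/\ P_hit P i w, ~ straightened P C i w,
      P_rearrangement P i w y & straightened P C i y].

(** The four words form a square: [w] to [x] and [y] to [z] change window [i], [w] to [y] and [x] to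
    [z] change window [j]. A step along one side is carried to the opposite side. *)
Lemma straightening_at_transport P C i j w x y z l : disjoint_windows i j ->
  hit_interval j w l -> agree_off j w y -> agree_off j x z ->
  agree_off i y z -> straightening_at P C i w x -> straightening_at P C i y z.
Proof.
move=> dij jwl wy xz yz [/P_hitE iw nsw /P_rearrangementE[wx Bwx] sx].
have wy_i := disjoint_agree_on dij wy; have xz_i := disjoint_agree_on dij xz.
have dji : disjoint_windows j i by rewrite disjoint_windows_sym.
split.
- exact/P_hitE/(in_block_agree_on wy_i wy_i).
- move=> sy; apply: nsw; apply: straightened_disjoint dij _ _ sy.
    exact: agree_off_sym wy.
  exact: agree_off_interval wy jwl.
- exact/P_rearrangementE/(conj yz)/(in_block_agree_on wy_i xz_i).
apply: straightened_disjoint dij xz _ sx.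
exact: agree_on_interval (disjoint_agree_on dji wx) jwl.
Qed.

Lemma straightening_at_commute P C i j w x y : disjoint_windows i j ->
  straightening_at P C i w x -> straightening_at P C j w y ->
  exists2 z, straightening_at P C j x z & straightening_at P C i y z.
Proof.
move=> dij iwx jwy.
have [[Bi _ /hit_in_interval[k iwk]] _ /P_rearrangementE[wx _] _] := iwx.
have [[Bj _ /hit_in_interval[l jwl]] _ /P_rearrangementE[wy _] _] := jwy.
have [z [yz xz _ _]] := transport dij wx wy; exists z.
  apply: (straightening_at_transport _ iwk wx yz xz jwy).
  by rewrite disjoint_windows_sym.
exact: (straightening_at_transport dij jwl wy xz yz iwx).
Qed.

(** For fixed [r], forward forces leaning to one given side, and backward means leaning to the other
    side or omni leaning. [C :&: B] has at most one member of each kind, and an omni leaning one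
    makes all of [B] omni leaning. *)
Lemma straightened_same_part P C B r u v : straightening_set P C -> B \in P ->
  u \in C :&: B -> v \in C :&: B ->
  backward_perm r u = backward_perm r v -> u = v.
Proof.
move=> [_ /(_ B)] strB /strB[card_l card_r card_o] uCB vCB; clear strB.
have omniB t : t \in C :&: B -> omni_leaning (word t) ->
    [forall t in B, omni_leaning (word t)].
  move=> tCB ot; rewrite -[X in is_true X]lt0b -card_o.
  by apply/card_gt0P; exists t; rewrite inE tCB.
have omni_all t t' : t \in C :&: B -> t' \in C :&: B ->
    omni_leaning (word t) -> omni_leaning (word t').
  move=> tCB /setIP[_ t'B] /(omniB _ tCB)/forall_inP; exact.
have same_l := card_le1_eq card_l uCB vCB.
have same_r := card_le1_eq card_r uCB vCB.
have same_o := card_le1_eq card_o uCB vCB.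
have ovu := omni_all _ _ vCB uCB; have ouv := omni_all _ _ uCB vCB.
move: same_l same_r same_o ovu ouv; rewrite /backward_perm /omni_leaning.
case: (left_leaning (word u)); case: (left_leaning (word v));
  case: (right_leaning (word u)); case: (right_leaning (word v));
  case: r => //= H1 H2 H3 H4 H5 H6; by [apply: H1 | apply: H2 | apply: H3
   | have := H4 isT | have := H5 isT].
Qed.

(** As parts are disjoint, [x] and [y] are rearrangements of each other. Both being straightened,
    they are both forward or both backward there, with the same polarization, so their patterns
    coincide. *)
Lemma straightening_at_unique P C i w x y : trivIset P ->
  straightening_set P C ->
  straightening_at P C i w x -> straightening_at P C i w y -> x = y.
Proof.
move=> tiP strC [_ _ /P_rearrangementE[wx [A AP [iwA ixA]]] [ixC sx]].
move=> [_ _ /P_rearrangementE[wy [B BP [iwB iyB]]] [iyC sy]].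
have [icn [s sA ws]] := iwA; have [_ [s' s'B ws']] := iwB.
have AB : A = B.
  apply: contraTeq sA => AB; rewrite (forms_inj icn ws ws').
  by rewrite (disjointFl ((trivIsetP tiP) _ _ AP BP AB) s'B).
have mem_CB (z : 'S_n) : hit_in C i z -> hit_in B i z ->
    exists2 u, u \in C :&: B & forms (subword c i (word z)) u.
  move=> [_ [u uC zu]] [_ [u' u'B zu']]; exists u => //.
  by rewrite inE uC (forms_inj icn zu zu').
rewrite AB in ixA iwA.
have [u uCB xu] := mem_CB x ixC ixA; have [v vCB yv] := mem_CB y iyC iyB.
have xy := agree_off_trans (agree_off_sym wx) wy.
have Pxy : P_rearrangement P i x y.
  by apply/P_rearrangementE; split=> //; exists B.
have Pyx : P_rearrangement P i y x.
  by apply/P_rearrangementE; split; [apply: agree_off_sym | exists B].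
have polar := right_polarized_agree_off icn xy.
have uv : u = v.
  apply: (straightened_same_part (r := right_polarized c i (word x))
    strC BP uCB vCB).
  rewrite -(backwardE icn xu) -polar -(backwardE icn yv).
  case: sx => [/negbTE fx|[bkx nx]]; case: sy => [/negbTE fy|[bky ny]].
  - by rewrite fx fy.
  - by case: ny; exists x => //; rewrite /forward fx.
  - by case: nx; exists y => //; rewrite /forward fy.
  by rewrite bkx bky.
apply: (hit_in_agree_off (u := u) xy).
  by split=> //; exists u; rewrite ?set11.
by split=> //; exists u; rewrite ?set11 // uv.
Qed.

(** * Adding an omni leaning permutation *)

Section Extension.

Variables (P P' : {set {set 'S_c}}) (C C' : {set 'S_c}) (o : 'S_c).
Hypothesis same_parts : forall u v, u != o -> v != o ->
  (exists2 B, B \in P' & (u \in B) && (v \in B)) <->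
  (exists2 B, B \in P & (u \in B) && (v \in B)).
Hypothesis same_C : forall u, u != o -> (u \in C') = (u \in C).
Hypothesis omni_o : omni_leaning (word o).

Lemma forms_neq i w u : (i + c <= n)%N -> ~ hit_in [set o] i w ->
  forms (subword c i (word w)) u -> u != o.
Proof.
by move=> icn nio wu; apply/eqP=> uo; apply: nio; split=> //; exists u;
  rewrite // uo set11.
Qed.

Lemma in_block_ext i w y : ~ hit_in [set o] i w -> ~ hit_in [set o] i y ->
  in_block P' i w y <-> in_block P i w y.
Proof.
move=> now noy; split=> -[B BP [[icn [u uB wu]] [_ [v vB yv]]]].
  have [toP _] := same_parts (forms_neq icn now wu) (forms_neq icn noy yv).
  have [|A AP /andP[uA vA]] := toP; first by exists B; rewrite ?uB.
  by exists A => //; split; split=> //; [exists u | exists v].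
have [_ toP'] := same_parts (forms_neq icn now wu) (forms_neq icn noy yv).
have [|A AP /andP[uA vA]] := toP'; first by exists B; rewrite ?uB.
by exists A => //; split; split=> //; [exists u | exists v].
Qed.

Lemma omni_hit_backward i w : hit_in [set o] i w -> backward c i (word w).
Proof.
case=> icn [_ /set1P-> wo].
by rewrite (backwardE icn wo) /backward_perm omni_o !orbT.
Qed.

Lemma P_rearrangement_ext i w y : ~ hit_in [set o] i w ->
  ~ hit_in [set o] i y ->
  P_rearrangement P' i w y <-> P_rearrangement P i w y.
Proof.
by move=> now noy; split=> /P_rearrangementE[wy] /(in_block_ext now noy) Bwy;
  apply/P_rearrangementE.
Qed.

(** A hit forming [o] is backward, so adding [o] offers no new way to make a hit forward. *)
Lemma straightened_ext i w : ~ hit_in [set o] i w ->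
  straightened P' C' i w <-> straightened P C i w.
Proof.
move=> now.
have fw_ext y : forward c i (word y) ->
    P_rearrangement P' i w y <-> P_rearrangement P i w y.
  move=> fy; apply: P_rearrangement_ext => // /omni_hit_backward oy.
  by rewrite /forward oy in fy.
split=> -[[icn [u uC wu]] iw]; (split; [split=> //; exists u => //|]).
- by rewrite -same_C // (forms_neq icn now wu).
- case: iw => [|[bw nw]]; [by left | right; split=> // -[y wy fy]].
  by apply: nw; exists y => //; apply/fw_ext.
- by rewrite same_C // (forms_neq icn now wu).
case: iw => [|[bw nw]]; [by left | right; split=> // -[y wy fy]].
by apply: nw; exists y => //; apply/fw_ext.
Qed.

Lemma straightening_at_ext i w y : ~ hit_in [set o] i w ->
  ~ hit_in [set o] i y ->
  straightening_at P' C' i w y <-> straightening_at P C i w y.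
Proof.
move=> now noy; split=> -[/P_hitE/(in_block_ext now now)/P_hitE iw nw wy sy].
  split=> //; first by move/(straightened_ext now).
    exact/(P_rearrangement_ext now noy).
  exact/(straightened_ext noy).
split=> //; first by move/(straightened_ext now).
  exact/(P_rearrangement_ext now noy).
exact/(straightened_ext noy).
Qed.

End Extension.

Lemma omni_hit_disjoint D (o : 'S_c) i j w : omni_leaning (word o) -> i != j ->
  hit_in [set o] i w -> hit_in D j w -> disjoint_windows i j.
Proof.
move=> omni_o ij iwo /hit_in_interval[l jwl].
have [k iwk] := hit_in_interval iwo.
case: iwo => icn [_ /set1P-> wo].
by apply: omni_disjoint ij iwk jwl _; rewrite (omni_leaning_forms wo).
Qed.

Lemma hit_not_omni D (o : 'S_c) i w : o \notin D -> hit_in D i w ->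
  ~ hit_in [set o] i w.
Proof.
move=> oD [icn [u uD wu]] [_ [_ /set1P-> wo]].
by rewrite -(forms_inj icn wu wo) uD in oD.
Qed.

Section AddOmni.

Variables (S : {set 'S_c}) (P : {set {set 'S_c}}) (C : {set 'S_c}) (o : 'S_c).
Hypothesis partP : partition P S.
Hypothesis strC : straightening_set P C.
Hypothesis confP : confluent (@straightening c n P C).
Hypothesis omni_o : omni_leaning (word o).
Hypothesis oNS : o \notin S.

Let oNC : o \notin C.
Proof.
by apply: contra oNS; rewrite -(cover_partition partP);
  apply/subsetP/(proj1 strC).
Qed.

Let oNP A : A \in P -> o \notin A.
Proof.
move=> AP; apply: contra oNS => oA.
by rewrite -(cover_partition partP); apply/bigcupP; exists A.
Qed.

(** * The singleton as a new part *)

Section NewPart.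

Let P' := [set o] |: P.
Let C' := o |: C.

Lemma new_part_straightening_set : straightening_set P' C'.
Proof.
have /andP[nr nl] := omni_o.
split=> [|A]; rewrite /P' /C'.
  rewrite /cover bigcup_setU big_set1 setUS //; exact: (proj1 strC).
case/setU1P=> [->|AP].
  have -> : (o |: C) :&: [set o] = [set o] by rewrite setIC;
    apply/setIidPl/subsetUl.
  have card_eq (a : pred 'S_c) : #|[set u in [set o] | a u]| = a o.
    case ao: (a o); last first.
      by apply: eq_card0 => u; rewrite !inE; case: eqP => // ->.
    rewrite -[RHS](cards1 o); apply: eq_card => u; rewrite !inE.
    by case: eqP => // ->.
  rewrite !card_eq; split; congr nat_of_bool.
  - by apply/idP/existsP=> [lo|[u /andP[/set1P->]]]; first by exists o;
      rewrite set11.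
  - by apply/idP/existsP=> [lo|[u /andP[/set1P->]]]; first by exists o;
      rewrite set11.
  by apply/idP/forall_inP=> [oo u /set1P->|/(_ o (set11 o))].
have -> : (o |: C) :&: A = C :&: A; last exact: (proj2 strC).
by rewrite setIUl (disjoint_setI0 _) ?set0U // disjoints1 oNP.
Qed.

Lemma new_part_straightening : @straightening c n P' C' = straightening P C.
Proof.
have same_parts u v : u != o -> v != o ->
    (exists2 B, B \in P' & (u \in B) && (v \in B)) <->
    (exists2 B, B \in P & (u \in B) && (v \in B)).
  move=> uo vo; split=> -[B BP uvB]; exists B => //; last by rewrite setU1r.
  by case/setU1P: BP uvB => // ->; rewrite !inE (negbTE uo).
have same_C u : u != o -> (u \in C') = (u \in C) by move=> uo;
  rewrite !inE (negbTE uo).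
have ext := straightening_at_ext same_parts same_C omni_o.
have single A : A \in P' -> o \in A -> A = [set o].
  by case/setU1P=> // /oNP/negbTE->.
have in_block_o i w y : in_block P' i w y ->
    hit_in [set o] i w <-> hit_in [set o] i y.
  case=> A AP' [[icn [u uA wu]] [_ [v vA yv]]]; split=> -[_ [_ /set1P-> fo]].
    have uo := forms_inj icn wu fo; rewrite uo in uA.
    by split=> //; exists v; rewrite // -(single _ AP' uA).
  have vo := forms_inj icn yv fo; rewrite vo in vA.
  by split=> //; exists u; rewrite // -(single _ AP' vA).
(* Every rearrangement within the part [[set o]] still forms [o], so it stays backward and the hit
   counts as straightened. *)
have o_straight i w : hit_in [set o] i w -> straightened P' C' i w.
  move=> iwo; split.
    by have [icn [u /set1P-> wo]] := iwo; split=> //; exists o; rewrite ?setU11.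
  right; split; first exact: omni_hit_backward iwo.
  case=> y /P_rearrangementE[_ /in_block_o/(proj1)/(_ iwo) iyo].
  by rewrite /forward (omni_hit_backward omni_o iyo).
apply/funext=> w; apply/funext=> y; apply/propext; split=> -[i wy]; exists i.
  have [_ nw /P_rearrangementE[_ /in_block_o wyo] _] := wy.
  have now : ~ hit_in [set o] i w by move/o_straight.
  by apply/ext => //; move/wyo.
have [_ _ /P_rearrangementE[_ [A AP [iwA iyA]]] _] := wy.
by apply/ext=> //; apply: (hit_not_omni (oNP AP)).
Qed.

End NewPart.

(** * Enlarging an existing part *)

Section ExtendedPart.

Variable B : {set 'S_c}.
Hypothesis BP : B \in P.
Let P' := (o |: B) |: (P :\ B).

(** Since [o] is not in [C], the cardinals do not change. Since [o] is omni leaning, neither do the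
    booleans they are compared with. *)
Lemma extended_part_straightening_set : straightening_set P' C.
Proof.
have /andP[nr nl] := omni_o.
split=> [|A].
  apply: subset_trans (proj1 strC) _; apply/bigcupsP=> A AP.
  have [->|AB] := eqVneq A B.
    apply: subset_trans (subsetUr [set o] B) _.
    by apply: (bigcup_max (o |: B)); rewrite ?setU11.
  by apply: (bigcup_max A); rewrite // !inE AB AP orbT.
case/setU1P=> [->|/setD1P[_ AP]]; last exact: (proj2 strC).
have -> : C :&: (o |: B) = C :&: B.
  by rewrite setIUr setIC (disjoint_setI0 _) ?set0U // disjoints1.
have [-> -> ->] := proj2 strC _ BP.
have ex_eq (a : pred 'S_c) : ~~ a o ->
    [exists u in B, a u] = [exists u in o |: B, a u].
  move=> nao; apply/exists_inP/exists_inP=> -[u uB au]; exists u => //.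
    by rewrite setU1r.
  by case/setU1P: uB au nao => // -> ->.
rewrite !ex_eq //; split=> //; congr nat_of_bool.
apply/forall_inP/forall_inP=> all_omni u uB.
  by case/setU1P: uB => [->//|/all_omni].
by apply: all_omni; rewrite setU1r.
Qed.

Lemma extended_part_trivIset : trivIset P'.
Proof.
have /and3P[_ /trivIsetP tiP _] := partP.
have disj X : X \in P -> X != B -> [disjoint o |: B & X].
  move=> XP XB; rewrite -setI_eq0 setIUl setU_eq0 !setI_eq0 disjoints1 oNP //.
  by apply: tiP; rewrite // eq_sym.
apply/trivIsetP=> X Y /setU1P[->|/setD1P[XB XP]] /setU1P[->|/setD1P[YB YP]] XY.
- by rewrite eqxx in XY.
- exact: disj.
- by rewrite disjoint_sym; apply: disj.
exact: tiP.
Qed.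

Local Notation step := (straightening_at P C).
Local Notation step' := (straightening_at P' C).

Let ext i w y : ~ hit_in [set o] i w -> ~ hit_in [set o] i y ->
  step' i w y <-> step i w y.
Proof.
apply: straightening_at_ext => // u v uo vo; split=> -[A AP' uvA].
  case/setU1P: AP' uvA => [->|/setD1P[_ AP] uvA]; last by exists A.
  by rewrite !inE (negbTE uo) (negbTE vo); exists B.
have [AB|AB] := eqVneq A B.
  by exists (o |: B); rewrite ?setU11 // -AB !inE; case/andP: uvA => -> ->;
    rewrite !orbT.
by exists A; rewrite // !inE AB AP' orbT.
Qed.

Let step'_not_omni i w y : step' i w y -> ~ hit_in [set o] i y.
Proof. by case=> _ _ _ [/(hit_not_omni oNC)]. Qed.

Let step_extended i w y : step i w y -> step' i w y.
Proof.
move=> wy; apply/ext => //.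
  by have [[A AP iwA] _ _ _] := wy; apply: hit_not_omni iwA; apply: oNP.
by case: wy => _ _ _ [/(hit_not_omni oNC)].
Qed.

(** The straightened hit forms a member of [C], so not [o]. A hit forming [o] after the step is thus
    elsewhere, disjoint from the changed window, and was already there. *)
Let step'_omni_hits i j w y : step' i w y -> hit_in [set o] j y ->
  hit_in [set o] j w.
Proof.
move=> wy jyo; have ji : j != i.
  by apply/eqP=> ji; rewrite ji in jyo; apply: step'_not_omni wy jyo.
have [_ _ /P_rearrangementE[wy_i [A _ [_ iyA]]] _] := wy.
have dji := omni_hit_disjoint omni_o ji jyo iyA.
exact: hit_in_agree_on (disjoint_agree_on dji (agree_off_sym wy_i)) jyo.
Qed.

Local Notation R := (@straightening c n P C).
Local Notation R' := (@straightening c n P' C).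

Lemma clos_extended w y : clos_refl_trans _ R w y -> clos_refl_trans _ R' w y.
Proof.
elim=> {w y} [w y [i wy]|w|w x y _ wx _ xy].
- by apply: rt_step; exists i; apply: step_extended.
- exact: rt_refl.
exact: rt_trans xy.
Qed.

Lemma clos_extended_omni_hits w y j : clos_refl_trans _ R' w y ->
  hit_in [set o] j y -> hit_in [set o] j w.
Proof.
by elim=> {w y} [w y [i /step'_omni_hits]|//|w x y _ wx _ xy /xy/wx]; apply.
Qed.

(* Straightening a hit forming [o] destroys that hit for ever, so it cannot
   happen on a path that preserves all of them. *)
Lemma clos_extended_same_omni_hits w y : clos_refl_trans _ R' w y ->
  (forall j, hit_in [set o] j w -> hit_in [set o] j y) ->
  clos_refl_trans _ R w y.
Proof.
move/clos_rt_rt1n_iff;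
  elim=> {w y} [w _|w x y [i wx] /clos_rt_rt1n_iff xy IH wy].
  exact: rt_refl.
have iNx := step'_not_omni wx.
have iNw : ~ hit_in [set o] i w.
  by move/wy/(clos_extended_omni_hits xy).
apply: rt_trans (IH _).
  by apply: rt_step; exists i; apply/ext.
by move=> j /(step'_omni_hits wx)/wy.
Qed.

Lemma extended_part_confluent : confluent R'.
Proof.
apply: newman_confluent => [w [i [_ nw _ /nw]]//|w y wy yw|w x y [i wx] [j wy]].
  (* Around a cycle no hit forming [o] appears, hence none disappears: both paths are paths for
     [R]. *)
  have hits_wy j := @clos_extended_omni_hits _ _ j wy.
  have hits_yw j := @clos_extended_omni_hits _ _ j yw.
  by apply: (proj1 confP); apply: clos_extended_same_omni_hits.
have commute : hit_in [set o] i w \/ hit_in [set o] j w ->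
    exists2 z, clos_refl_trans _ R' x z & clos_refl_trans _ R' y z.
  move=> omni_ij; have [ij|ij] := eqVneq i j.
    rewrite -ij in wy; exists x; first exact: rt_refl.
    rewrite (straightening_at_unique extended_part_trivIset
      extended_part_straightening_set wx wy).
    exact: rt_refl.
  have dij : disjoint_windows i j.
    have [[A _ iwA] _ _ _] := wx; have [[A' _ jwA'] _ _ _] := wy.
    case: omni_ij => [iwo|jwo]; first exact: (omni_hit_disjoint _ ij iwo jwA').
    rewrite disjoint_windows_sym; rewrite eq_sym in ij.
    exact: (omni_hit_disjoint _ ij jwo iwA).
  have [z xz yz] := straightening_at_commute dij wx wy.
  by exists z; apply: rt_step; [exists j | exists i].
have [iwo|iNw] := pselect (hit_in [set o] i w); first by apply: commute; left.
have [jwo|jNw] := pselect (hit_in [set o] j w); first by apply: commute; right.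
have /(ext iNw (step'_not_omni wx)) Rwx := wx.
have /(ext jNw (step'_not_omni wy)) Rwy := wy.
(* Two old steps are joined at the sink of the [R]-component of [w]. *)
have [m [[wm sink] _]] := proj2 confP w.
exists m; apply: clos_extended; apply: sink; apply: rst_step.
  by exists i.
by exists j.
Qed.

End ExtendedPart.
End AddOmni.

End Windows.

Theorem theorem2p7 (c n : nat) (c_gt0 : (0 < c)%N) (le_cn : (c <= n)%N)
    (S : {set 'S_c}) (P : {set {set 'S_c}}) (partP : partition P S)
    (C : {set 'S_c}) (strC : straightening_set P C)
    (confP : C_confluent n P C)
    (o : 'S_c) (omni_o : o \in omni_perms c) (oNS : o \notin S) :
  (forall B : {set 'S_c}, B \in P ->
     C_confluent n ((o |: B) |: (P :\ B)) C)
  /\ C_confluent n ([set o] |: P) (o |: C).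
Proof.
have [_ conf] := confP; rewrite inE in omni_o; split=> [B BP|].
  split; first exact: (extended_part_straightening_set (S := S)).
  exact: (extended_part_confluent c_gt0 partP).
split; first exact: (new_part_straightening_set (S := S)).
by rewrite (new_part_straightening n c_gt0 C partP).
Qed.
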